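(* Let $\epsilon>0$, $\delta\in(0,1)$, and let $\mathbf{s}=(s_1,\ldots,s_r)$ be a real-valued query with finite $l_2$ global sensitivity $\Delta_2=\max_{d(\mathbf{x},\mathbf{x}')=1}\|\mathbf{s}(\mathbf{x})-\mathbf{s}(\mathbf{x}')\|_2$. Consider the Gaussian mechanism with scale parameter $b>0$, which given data $\mathbf{x}$ releases $\mathbf{s}^*=(s_1^*,\ldots,s_r^* )$ with $s_k^*$ drawn independently from the Gaussian distribution with mean $s_k(\mathbf{x})$ and variance $b^2/2$. If $$b\ge2^{-1/2}\epsilon^{-1}\Delta_2\left(\sqrt{(\Phi^{-1}(\delta/2))^2+2\epsilon}-\Phi^{-1}(\delta/2)\right),$$ then the mechanism satisfies $(\epsilon,\delta)$-probabilistic differential privacy.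
   Context: $d(\mathbf{x},\mathbf{x}')=1$ is a symmetric neighboring relation on data sets (they differ by one individual); maxima are understood as suprema. $\Phi$ is the cumulative distribution function of the standard normal distribution. A mechanism with output density $f(\cdot\mid\mathbf{x})$ satisfies $(\epsilon,\delta)$-probabilistic differential privacy (pDP) if for all $\mathbf{x},\mathbf{x}'$ with $d(\mathbf{x},\mathbf{x}')=1$, when $\mathbf{s}^*$ is drawn from $f(\cdot\mid\mathbf{x})$, $\Pr\left(\left|\log\left(f(\mathbf{s}^*\mid\mathbf{x})/f(\mathbf{s}^*\mid\mathbf{x}')\right)\right|>\epsilon\right)\le\delta$. *)

(* Defs.v *)
From HB Require Import structures.
From mathcomp Require Import all_boot all_order all_algebra.
From mathcomp Require Import all_classical all_reals all_analysis.

Set Implicit Arguments.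
Unset Strict Implicit.
Unset Printing Implicit Defensive.

Import Order.TTheory GRing.Theory Num.Theory.
Import numFieldNormedType.Exports.

Local Open Scope classical_set_scope.
Local Open Scope ring_scope.

Section tuple_product.
Context {d : measure_display} {T : measurableType d} {R : realType}.
Local Open Scope ereal_scope.

Definition cons_pair n (p : T * n.-tuple T) : n.+1.-tuple T :=
  [tuple of p.1 :: p.2].

Lemma measurable_cons_pair n :
  measurable_fun [set: T * n.-tuple T] (@cons_pair n).
Proof. exact: measurable_cons. Qed.

HB.instance Definition _ n := isMeasurableFun.Build _ _ _ _
  (@cons_pair n) (@measurable_cons_pair n).

Definition cons_measure n (m1 : {sigma_finite_measure set T -> \bar R})
    (m2 : {sigma_finite_measure set (n.-tuple T) -> \bar R}) :
    set (n.+1.-tuple T) -> \bar R :=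
  pushforward (m1 \x m2) (@cons_pair n).

Section cons_measure.
Variable n : nat.
Variable m1 : {sigma_finite_measure set T -> \bar R}.
Variable m2 : {sigma_finite_measure set (n.-tuple T) -> \bar R}.

Let cons_measure0 : cons_measure m1 m2 set0 = 0.
Proof. exact: measure0. Qed.

Let cons_measure_ge0 A : 0 <= cons_measure m1 m2 A.
Proof. exact: measure_ge0. Qed.

Let cons_measure_sigma_additive : semi_sigma_additive (cons_measure m1 m2).
Proof. exact: measure_semi_sigma_additive. Qed.

HB.instance Definition _ := isMeasure.Build _ _ _ (cons_measure m1 m2)
  cons_measure0 cons_measure_ge0 cons_measure_sigma_additive.

(* The library's sigma-finite instance on m1 \x m2 is shadowed by the one for
   subprobabilities, hence the direct argument. *)
Let cons_measure_sigma_finite : sigma_finite [set: _] (cons_measure m1 m2).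
Proof.
have /sigma_finiteP[F [TF ndF Foo]] := sigma_finiteT m1.
have /sigma_finiteP[G [TG ndG Goo]] := sigma_finiteT m2.
pose hd (t : n.+1.-tuple T) : T := tnth t ord0.
pose tl (t : n.+1.-tuple T) : n.-tuple T := [tuple of behead t].
have mhd : measurable_fun setT hd by exact: measurable_tnth.
have mtl : measurable_fun setT tl by exact: measurable_behead.
exists (fun k => hd @^-1` F k `&` tl @^-1` G k).
  apply/esym; rewrite -subTset => t _.
  have : [set: T] (hd t) by [].
  rewrite TF => -[i _ Fi].
  have : [set: n.-tuple T] (tl t) by [].
  rewrite TG => -[j _ Gj].
  exists (maxn i j) => //; split => /=.
    by move: (hd t) Fi; exact/subsetPset/ndF/leq_maxl.
  by move: (tl t) Gj; exact/subsetPset/ndG/leq_maxr.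
move=> k; have [mF Fk] := Foo k; have [mG Gk] := Goo k; split.
  apply: measurableI; rewrite -[X in measurable X]setTI.
    exact: mhd.
  exact: mtl.
have -> : cons_measure m1 m2 (hd @^-1` F k `&` tl @^-1` G k) =
    (m1 \x m2) (F k `*` G k).
  have tlK p : tl (cons_pair p) = p.2 by apply/val_inj.
  congr (product_measure1 _ _ _).
  by apply/seteqP; split=> -[a t] /=; rewrite tlK.
by rewrite product_measure1E// lte_mul_pinfty// ge0_fin_numE.
Qed.

HB.instance Definition _ := Measure_isSigmaFinite.Build _ _ _
  (cons_measure m1 m2) cons_measure_sigma_finite.

End cons_measure.

(* The product measure m_0 \x ... \x m_(n-1) on n-tuples, carried by the
   sigma-algebra generated by the coordinates; see tuple_measure_box. *)
Fixpoint tuple_measure n :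
    ('I_n -> {sigma_finite_measure set T -> \bar R}) ->
    {sigma_finite_measure set (n.-tuple T) -> \bar R} :=
  match n with
  | 0 => fun=> \d_([tuple] : 0.-tuple T)
  | n'.+1 => fun m =>
      cons_measure (m ord0) (tuple_measure (fun i => m (lift ord0 i)))
  end.

Lemma tuple_measure_box n (m : 'I_n -> {sigma_finite_measure set T -> \bar R})
    (A : 'I_n -> set T) : (forall i, measurable (A i)) ->
  tuple_measure m [set t | forall i, A i (tnth t i)] = \prod_(i < n) m i (A i).
Proof.
elim: n m A => [|n IH] m A mA.
  rewrite big_ord0 /= (_ : [set _ | _] = setT) ?diracT//.
  by apply/seteqP; split=> // t _ [].
rewrite big_ord_recl -IH; last by move=> i; exact: mA.
rewrite /= /cons_measure /pushforward.
pose B := [set t : n.-tuple T | forall i, A (lift ord0 i) (tnth t i)].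
have mB : measurable B.
  rewrite (_ : B = \bigcap_(i in [set: 'I_n])
      ((fun t : n.-tuple T => tnth t i) @^-1` A (lift ord0 i))).
    apply: fin_bigcap_measurable => // i _; rewrite -[X in measurable X]setTI.
    by apply: measurable_tnth => //; exact: mA.
  by apply/seteqP; split=> [t Bt i _|t Bt i] /=; [exact: Bt|exact: (Bt i)].
rewrite -(product_measure1E (m ord0) _ (mA ord0) mB).
congr (product_measure1 _ _ _); apply/seteqP; split=> -[a t] /=.
  move=> At; split; first exact: (At ord0).
  by move=> i; have := At (lift ord0 i); rewrite /cons_pair tnthS.
by move=> [Aa Bt] i; have [j ->|->] := unliftP ord0 i; rewrite ?tnthS.
Qed.

Lemma tuple_measureT n (P : 'I_n -> probability T R) :
  tuple_measure (fun i => P i) [set: n.-tuple T] = 1.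
Proof.
elim: n P => [|n IH] P /=; first by rewrite diracT.
rewrite /cons_measure /pushforward preimage_setT -setXTT product_measure1E//.
have /= -> := probability_setT (P ord0).
by rewrite mul1e; exact: (IH (fun i => P (lift ord0 i))).
Qed.

End tuple_product.

Section gaussian_mechanism.
Context {R : realType}.
(* lebesgue_measure and normal_prob live on this copy of R. *)
Local Notation Rn n := (n.-tuple (measurableTypeR R)).

Definition lebesgue_tuple n : {sigma_finite_measure set (Rn n) -> \bar R} :=
  tuple_measure (fun=> lebesgue_measure).

Definition has_density n (P : set (Rn n) -> \bar R)
    (f : Rn n -> R) : Prop :=
  [/\ measurable_fun setT f, forall t, 0 <= f t &
      forall A, measurable A ->
        P A = (\int[lebesgue_tuple n]_(t in A) (f t)%:E)%E].

(* The log-ratio is taken in \bar R, where a / 0 = +oo for a > 0, lne +oo = +oo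
   and lne 0 = -oo, so that points where exactly one of the two densities
   vanishes do count as having an infinite privacy loss (with real-valued ln and
   division they would count as having none).  The densities of M are determined
   up to Lebesgue-null sets, and M x is absolutely continuous, so the probability
   below does not depend on the choice of f. *)
Definition pDP (X : Type) (nbr : X -> X -> Prop) n
    (M : X -> probability (Rn n) R) (eps delta : R) : Prop :=
  exists f : X -> Rn n -> R,
    (forall x, has_density (M x) (f x)) /\
    forall x x', nbr x x' ->
      (M x [set t | eps%:E < `|lne ((f x t)%:E / (f x' t)%:E)|] <= delta%:E)%E.

Definition l2_dist n (u v : n.-tuple R) : R :=
  Num.sqrt (\sum_(k < n) (tnth u k - tnth v k) ^+ 2).

Definition neighbor_l2_dists (X : Type) (nbr : X -> X -> Prop) n
    (s : X -> n.-tuple R) : set R :=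
  [set D | exists x x', nbr x x' /\ D = l2_dist (s x) (s x')].

(* Finiteness of the supremum is has_ubound (neighbor_l2_dists nbr s); when there
   are no neighbours this real supremum is 0. *)
Definition l2_sensitivity (X : Type) (nbr : X -> X -> Prop) n
    (s : X -> n.-tuple R) : R := sup (neighbor_l2_dists nbr s).

(* The second parameter of normal_prob is the standard deviation. *)
Definition gaussian_law (b : R) n (m : n.-tuple R) :
    set (Rn n) -> \bar R :=
  tuple_measure (fun k => normal_prob (tnth m k) (Num.sqrt (b ^+ 2 / 2))).

HB.instance Definition _ b n m := Measure.copy (@gaussian_law b n m)
  (tuple_measure (fun k => normal_prob (tnth m k) (Num.sqrt (b ^+ 2 / 2)))).

Lemma gaussian_lawT b n m : @gaussian_law b n m setT = 1%E.
Proof.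
exact: tuple_measureT
  (fun k => normal_prob (tnth m k) (Num.sqrt (b ^+ 2 / 2)) : probability _ R).
Qed.

HB.instance Definition _ b n m := Measure_isProbability.Build _ _ _
  (@gaussian_law b n m) (gaussian_lawT b m).

Definition gaussian_mechanism (X : Type) n (s : X -> n.-tuple R) (b : R)
    (x : X) : probability (Rn n) R := gaussian_law b (s x).

Definition Phi (z : R) : R := fine (normal_prob 0 1 `]-oo, z]).

(* A preimage of p under Phi (unique, Phi being injective) whenever p is in the
   range of Phi; the default value 0 is only taken outside that range. *)
Definition Phi_inv : R -> R := 'pinv_(fun=> 0) [set: R] Phi.

End gaussian_mechanism.

(* Main.v *)
(* Let D = |s(x) - s(x')|_2, let sigma = b / sqrt 2 be the standard deviation of
   the noise, and eta = D / sigma.  The log-ratio of the two product densities is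
   affine in the output: <s(x) - s(x'), s* - s(x)> / sigma^2 + eta^2 / 2.  A linear
   form in independent Gaussians is Gaussian, so under s(x) the privacy loss is
   eta Z + eta^2 / 2 with Z standard normal, and the probability that it exceeds
   eps in absolute value is at most 2 P(Z >= eps / eta - eta / 2).  With
   q = Phi^-1(delta / 2), this is at most 2 Phi(q) = delta as soon as
   eta^2 - 2 q eta - 2 eps <= 0, which follows from eta <= sqrt(q^2 + 2 eps) + q;
   as (sqrt(q^2 + 2 eps) + q) (sqrt(q^2 + 2 eps) - q) = 2 eps, the latter is the
   hypothesis on b. *)
From HB Require Import structures.
Require Import Defs.
From mathcomp Require Import all_boot all_order all_algebra.
From mathcomp Require Import all_classical all_reals all_analysis.
From mathcomp Require Import measurable_realfun ring lra.

Import Order.TTheory GRing.Theory Num.Theory.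
Import numFieldNormedType.Exports.

Local Open Scope classical_set_scope.
Local Open Scope ring_scope.

(** * Integration against a measure that has a density *)

Section density.
Local Open Scope ereal_scope.
Context d (T : measurableType d) (R : realType).
Variables (mu nu : {measure set T -> \bar R}) (h : T -> R).
Hypotheses (mh : measurable_fun setT h) (h_ge0 : forall x, (0 <= h x)%R).
Hypothesis nuE : forall A, measurable A -> nu A = \int[mu]_(x in A) (h x)%:E.

Import HBNNSimple.

(** [nuE] is the case of indicators. Linearity extends it to the simple functions [g_ n] that
    increase to [g], and monotone convergence on both sides gives the limit. *)
Lemma ge0_integral_density (g : T -> \bar R) :
  measurable_fun setT g -> (forall x, 0 <= g x) ->
  \int[nu]_x g x = \int[mu]_x (g x * (h x)%:E).
Proof.
move=> mg g0; pose g_ := nnsfun_approx measurableT mg.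
have gE x : g x = limn (EFin \o g_ ^~ x).
  by apply/esym/cvg_lim => //; apply: cvg_nnsfun_approx.
have mgh n : measurable_fun setT (fun x => (g_ n x)%:E * (h x)%:E).
  by apply: emeasurable_funM; exact/measurable_EFinP.
transitivity (limn (fun n => \int[nu]_x (g_ n x)%:E)).
  rewrite -monotone_convergence//.
  - by apply: eq_integral => x _; exact: gE.
  - by move=> n; exact/measurable_EFinP.
  - by move=> n x _; rewrite lee_fin.
  - by move=> x _ m n mn; rewrite lee_fin; exact/lefP/nd_nnsfun_approx.
transitivity (limn (fun n => \int[mu]_x ((g_ n x)%:E * (h x)%:E))); last first.
  rewrite -monotone_convergence//.
  - apply: eq_integral => x _; apply/cvg_lim => //.
    apply: cvgeZr => //.
    by apply: cvg_nnsfun_approx.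
  - by move=> n x _; rewrite mule_ge0// lee_fin.
  - move=> x _ m n mn; rewrite lee_wpmul2r ?lee_fin//.
    exact/lefP/nd_nnsfun_approx.
congr (limn _); apply/funext => n.
under eq_integral do rewrite fimfunE -fsumEFin//.
rewrite ge0_integral_fsum//; last 2 first.
- by move=> r; exact/measurable_EFinP/measurable_funM.
- by move=> r x _; rewrite nnfun_muleindic_ge0.
transitivity (\sum_(r \in range (g_ n))
    \int[mu]_x ((r * \1_(g_ n @^-1` [set r]) x)%:E * (h x)%:E)).
  apply: eq_fsbigr => r _.
  (* A negative [r] is not a value of the nonnegative [g_ n], so its preimage is empty and both
     integrals vanish; a nonnegative [r] can be pulled out of them. *)
  have [r0|r0] := leP 0%R r; last first.
    rewrite preimage_nnfun0// !integral0_eq// => x _.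
      by rewrite indic0 mulr0 mul0e.
    by rewrite indic0 mulr0.
  under eq_integral do rewrite EFinM.
  under [RHS]eq_integral do rewrite EFinM -muleA.
  rewrite ge0_integralZl//=; first last.
  - exact/measurable_EFinP.
  rewrite ge0_integralZl//=; first last.
  - by move=> x _; rewrite mule_ge0// lee_fin.
  - by apply: emeasurable_funM; exact/measurable_EFinP.
  rewrite integral_indic// setIT nuE// [in LHS]integral_mkcond.
  congr (_ * _); apply: eq_integral => x _.
  by rewrite patchE indicE; case: ifPn; rewrite ?mul1e ?mul0e.
rewrite -ge0_integral_fsum//.
- apply: eq_integral => x _; rewrite [in RHS]fimfunE -fsumEFin//.
  rewrite ge0_mule_fsuml// => r; exact: nnfun_muleindic_ge0.
- move=> r; apply: emeasurable_funM; last exact/measurable_EFinP.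
  exact/measurable_EFinP/measurable_funM.
- move=> r x _; apply: mule_ge0; last by rewrite lee_fin.
  exact: nnfun_muleindic_ge0.
Qed.

End density.

(** * Affine changes of variable for Lebesgue measure and Gaussian laws *)

Section affine.
Context {R : realType}.
Notation mu := (@lebesgue_measure R).
Variables (a c : R).
Hypothesis a0 : a != 0.
Let f (x : measurableTypeR R) : measurableTypeR R := a * x + c.

Let mf : measurable_fun [set: measurableTypeR R] f.
Proof. by apply: measurable_funD => //; exact: measurable_funM. Qed.

(** By uniqueness of Lebesgue measure it is enough to compare the two sides on the intervals []x,
    y]]. *)
Lemma lebesgue_measure_affine (A : set R) : measurable A ->
  mu A = (`|a|%:E * pushforward mu f A)%E.
Proof.
pose na : {nonneg R} := NngNum (normr_ge0 a).
apply: (@lebesgue_measure_unique R (mscale na (pushforward mu f))) => _ [[x y]] _ <-.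
rewrite lebesgue_measure_itv/= -[RHS]/(`|a|%:E * mu (f @^-1` `]x, y]))%E.
(* For negative [a] the endpoints are exchanged and the preimage is closed on the left and open on
   the right; its length is still [(y - x) / |a|]. *)
have [a_lt0|a_gt0|] := ltgtP a 0; last by move/eqP; rewrite (negbTE a0).
  rewrite (_ : _ @^-1` _ = `[(y - c) / a, (x - c) / a[%classic); last first.
    apply/seteqP; split => z /=; rewrite !in_itv/= => /andP[h1 h2].
      by rewrite ler_ndivrMr// ltr_ndivlMr// lerBrDr ltrBlDr mulrC h1 h2.
    move: h1 h2; rewrite ler_ndivrMr// ltr_ndivlMr// lerBrDr ltrBlDr mulrC.
    by move=> -> ->.
  rewrite lebesgue_measure_itv/= !lte_fin ltr_nM2r ?invr_lt0// ltrD2r.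
  case: ifPn => // _; rewrite ?mule0// -!EFinB -EFinM; congr (_%:E).
  by rewrite ltr0_norm//; field.
rewrite (_ : _ @^-1` _ = `](x - c) / a, (y - c) / a]%classic); last first.
  apply/seteqP; split => z /=; rewrite !in_itv/= => /andP[h1 h2].
    by rewrite ler_pdivlMr// ltr_pdivrMr// lerBrDr ltrBlDr mulrC h1 h2.
  move: h1 h2; rewrite ler_pdivlMr// ltr_pdivrMr// lerBrDr ltrBlDr mulrC.
  by move=> -> ->.
rewrite lebesgue_measure_itv/= !lte_fin ltr_pM2r ?invr_gt0// ltrD2r.
case: ifPn => // _; rewrite ?mule0// -!EFinB -EFinM; congr (_%:E).
by rewrite gtr0_norm//; field.
Qed.

Lemma ge0_integral_affine (A : set R) (g : R -> \bar R) : measurable A ->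
  measurable_fun setT g -> (forall x, 0 <= g x)%E ->
  (\int[mu]_(x in A) g x =
   `|a|%:E * \int[mu]_(x in f @^-1` A) g (f x))%E.
Proof.
move=> mA mg g0.
pose na : {nonneg R} := NngNum (normr_ge0 a).
have -> : (\int[mu]_(x in f @^-1` A) g (f x) =
          \int[pushforward mu f]_(x in A) g x)%E.
  by rewrite ge0_integral_pushforward//; exact: measurable_funS mg.
pose nu : {measure set (measurableTypeR R) -> \bar R} :=
  mscale na (pushforward mu f).
transitivity (\int[nu mf]_(x in A) g x)%E.
  apply: eq_measure_integral => /= B mB _; exact: lebesgue_measure_affine.
by rewrite ge0_integral_mscale//; exact: measurable_funS mg.
Qed.

(** The factor [|a|] from the change of variable is absorbed by the normalising constant, as the
    peak for [a * sigma] is [|a|] times smaller than the peak for [sigma]. *)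
Lemma normal_prob_affine (m sigma : R) (A : set R) : sigma != 0 ->
  measurable A ->
  normal_prob m sigma (f @^-1` A) = normal_prob (a * m + c) (a * sigma) A.
Proof.
move=> s0 mA; rewrite /normal_prob.
have pdfE x : (normal_pdf m sigma x)%:E =
    (`|a|%:E * (normal_pdf (a * m + c) (a * sigma) (f x))%:E)%E.
  rewrite -EFinM !normal_pdfE ?mulf_neq0//; congr (_%:E).
  rewrite mulrA; congr (_ * _); last first.
    rewrite /normal_fun /f; congr expR.
    by field; rewrite a0 s0.
  rewrite /normal_peak.
  have -> : (a * sigma) ^+ 2 * pi *+ 2 = a ^+ 2 * (sigma ^+ 2 * pi *+ 2).
    by ring.
  rewrite [in RHS]sqrtrM ?sqr_ge0// sqrtr_sqr.
  by rewrite invfM mulrA divff ?mul1r ?normr_eq0.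
under eq_integral do rewrite pdfE.
rewrite ge0_integralZl//; first last.
- by move=> x _; rewrite lee_fin normal_pdf_ge0.
- apply/measurable_EFinP/measurable_funTS.
  by apply: (measurableT_comp (measurable_normal_pdf _ _)).
- by rewrite -[X in measurable X]setTI; exact: mf.
apply/esym/(@ge0_integral_affine A (EFin \o normal_pdf _ _)) => //.
- by apply/measurable_EFinP; exact: measurable_normal_pdf.
- by move=> x; rewrite lee_fin normal_pdf_ge0.
Qed.

End affine.

(** * Sums of independent Gaussians, degenerate ones included *)

Section normal_or_dirac.
Context {R : realType}.
Notation mu := (@lebesgue_measure R).

(** The density sees [s] only through its square and the test [s == 0]. This permits negative scale
    parameters, which affine maps with negative slope produce. *)
Lemma normal_prob_sqr (m s t : R) : s ^+ 2 = t ^+ 2 ->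
  normal_prob m s = normal_prob m t.
Proof.
move=> st; have st0 : (s == 0) = (t == 0).
  by rewrite -(sqrf_eq0 s) st sqrf_eq0.
apply/funext => A; rewrite /normal_prob; apply: eq_integral => x _.
by rewrite /normal_pdf /normal_peak /normal_fun st st0.
Qed.

(* [normal_prob m 0] is a junk uniform law, not the point mass at [m]. *)
Definition normal_or_dirac (m s : R) : set (measurableTypeR R) -> \bar R :=
  if s == 0 then \d_m else normal_prob m s.

(* Completing the square in [x]. *)
Lemma normal_pdf_conv (a m1 s1 m2 s2 S x y : R) : s1 != 0 -> s2 != 0 ->
  S ^+ 2 = a ^+ 2 * s1 ^+ 2 + s2 ^+ 2 ->
  normal_pdf m1 s1 x * normal_pdf m2 s2 (y - a * x) =
  normal_pdf (a * m1 + m2) S y *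
  normal_pdf ((m1 * s2 ^+ 2 + a * s1 ^+ 2 * (y - m2)) / S ^+ 2)
    (s1 * s2 / S) x.
Proof.
move=> s10 s20 SE.
have S20 : a ^+ 2 * s1 ^+ 2 + s2 ^+ 2 != 0.
  rewrite gt_eqF// ltr_wpDl ?exprn_even_gt0//.
  exact: mulr_ge0 (sqr_ge0 _) (sqr_ge0 _).
have S0 : S != 0 by rewrite -sqrf_eq0 SE.
rewrite !normal_pdfE ?mulf_neq0 ?invr_neq0//.
rewrite mulrACA [RHS]mulrACA; congr (_ * _).
  (* A product of two peaks depends only on the product of the scales, which is [s1 * s2] on both
     sides. *)
  have peakM (u v : R) : normal_peak u * normal_peak v =
      (Num.sqrt ((u * v) ^+ 2 * (pi *+ 2) ^+ 2))^-1.
    rewrite /normal_peak -invfM -sqrtrM; last first.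
      by apply/mulrn_wge0/mulr_ge0; [exact: sqr_ge0|exact: pi_ge0].
    by congr (Num.sqrt _)^-1; ring.
  by rewrite !peakM [S * _]mulrC divfK.
rewrite /normal_fun -!expRD; congr expR.
rewrite exprMn exprVn exprMn SE.
field.
by rewrite exprMn S20 s10 s20.
Qed.

(** This is the law of [a * X + Y] for independent [X] and [Y], the inductive step for linear forms.
    The point mass must be allowed for [Y], since a linear form may have zero coefficients. *)
Lemma normal_conv (a m1 s1 m2 s2 : R) (A : set R) : s1 != 0 -> measurable A ->
  (\int[normal_prob m1 s1]_x
     normal_or_dirac m2 s2 ((fun y => a * x + y)%R @^-1` A) =
   normal_or_dirac (a * m1 + m2) (Num.sqrt (a ^+ 2 * s1 ^+ 2 + s2 ^+ 2)) A)%E.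
Proof.
move=> s10 mA; rewrite /normal_or_dirac.
have as0 : 0 <= a ^+ 2 * s1 ^+ 2.
  exact: mulr_ge0 (sqr_ge0 _) (sqr_ge0 _).
(* Here [Y] is constant, so the integrand is the indicator of [a * x + m2] lying in [A], and the
   result is an affine image of the first law. *)
have [->|s20] := eqVneq s2 0.
  rewrite expr0n/= addr0.
  have [->|a0] := eqVneq a 0.
    rewrite expr0n/= !mul0r sqrtr0 eqxx add0r.
    have pre0 : (fun y => 0 + y) @^-1` A = A.
      by apply/seteqP; split => y /=; rewrite add0r.
    under eq_integral do rewrite mul0r pre0.
    by rewrite integral_cst//= probability_setT mule1.
  have as_gt0 : 0 < a ^+ 2 * s1 ^+ 2 by rewrite mulr_gt0// exprn_even_gt0.
  rewrite sqrtr_eq0 leNgt as_gt0/=.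
  (* The affine image has scale [a * s1], possibly negative; only its square matters. *)
  rewrite (_ : normal_prob _ (Num.sqrt _) = normal_prob (a * m1 + m2) (a * s1)).
    rewrite -normal_prob_affine// -[X in _ = normal_prob _ _ X]setIT.
    rewrite -integral_indic//.
    rewrite -[X in measurable X]setTI.
    suff : measurable_fun [set: measurableTypeR R] (fun x => a * x + m2).
      exact.
    by apply: measurable_funD => //; exact: measurable_funM.
  by apply: normal_prob_sqr; rewrite sqr_sqrtr// exprMn.
have S0 : 0 < a ^+ 2 * s1 ^+ 2 + s2 ^+ 2.
  by rewrite ltr_wpDl// exprn_even_gt0.
rewrite sqrtr_eq0 leNgt S0/=.
set S := Num.sqrt _; have SE : S ^+ 2 = a ^+ 2 * s1 ^+ 2 + s2 ^+ 2.
  by rewrite sqr_sqrtr// ltW.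
(* [p.1] is the value of [X] and [p.2] that of the sum, so the set [A] no longer depends on [x]. *)
pose G (p : measurableTypeR R * measurableTypeR R) : R :=
  normal_pdf m2 s2 (p.2 - a * p.1) * \1_A p.2.
have mG : measurable_fun setT G.
  apply: measurable_funM.
    apply: (measurableT_comp (measurable_normal_pdf m2 s2)) => /=.
    by apply: measurable_funB => //; exact: measurable_funM.
  have mA1 : measurable_fun [set: measurableTypeR R] (\1_A : _ -> R).
    exact: measurable_indic.
  exact: (measurableT_comp mA1 measurable_snd).
have G0 p : (0 <= (G p)%:E)%E.
  by rewrite lee_fin mulr_ge0// normal_pdf_ge0.
have shift x : normal_prob m2 s2 ((fun y => a * x + y) @^-1` A) =
    (\int[mu]_y (G (x, y))%:E)%E.
  rewrite (_ : (fun y => _) = (fun y => 1 * y + a * x)); last first.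
    by apply/funext => y; rewrite mul1r addrC.
  rewrite normal_prob_affine ?oner_eq0// !mul1r /normal_prob.
  rewrite integral_mkcond; apply: eq_integral => y _.
  rewrite patchE /G/= indicE; case: ifPn => _; rewrite ?mulr1 ?mulr0//.
  rewrite !normal_pdfE// /normal_fun.
  by rewrite (_ : y - (m2 + a * x) = y - a * x - m2)//; ring.
under eq_integral do rewrite shift.
rewrite (@ge0_integral_density _ _ _ mu _ (normal_pdf m1 s1))//; last 4 first.
- exact: measurable_normal_pdf.
- exact: normal_pdf_ge0.
- apply: (@measurable_fun_fubini_tonelli_F _ _ _ _ _ mu (EFin \o G)) => //.
  exact/measurable_EFinP.
- by move=> x; apply: integral_ge0.
pose F (p : measurableTypeR R * measurableTypeR R) : R :=
  G p * normal_pdf m1 s1 p.1.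
transitivity (\int[mu]_x \int[mu]_y (F (x, y))%:E)%E.
  apply: eq_integral => x _; rewrite -ge0_integralZr//.
  - apply/measurable_EFinP.
    exact: (measurableT_comp mG (measurable_pair1 x)).
  - by rewrite lee_fin normal_pdf_ge0.
(* After the exchange [x] is integrated first: for fixed [y], [normal_pdf_conv] leaves a Gaussian
   density in [x], of total mass 1, times the density of the sum at [y]. *)
rewrite (fubini_tonelli (EFin \o F)); last 2 first.
- apply/measurable_EFinP; apply: measurable_funM => //.
  exact: (measurableT_comp (measurable_normal_pdf m1 s1) measurable_fst).
- by move=> p; rewrite /= EFinM mule_ge0// lee_fin normal_pdf_ge0.
rewrite [RHS]integral_mkcond; apply: eq_integral => y _ /=.
rewrite patchE; case: ifPn => yA; last first.
  by apply: integral0_eq => x _; rewrite /F /G/= indicE (negbTE yA) mulr0 mul0r.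
under eq_integral do
  rewrite /F /G/= indicE yA mulr1 mulrC
    (normal_pdf_conv _ _ _ _ _ _ _ _ s10 s20 SE) EFinM.
rewrite ge0_integralZl//; last 3 first.
- by apply/measurable_EFinP; exact: measurable_normal_pdf.
- by move=> x _; rewrite lee_fin normal_pdf_ge0.
- by rewrite lee_fin normal_pdf_ge0.
by rewrite integral_normal_pdf mule1.
Qed.

End normal_or_dirac.

(** * Linear forms and densities under product measures on tuples *)

Section tuples.
Context {R : realType}.
Notation mu := (@lebesgue_measure R).
Notation Rn n := (n.-tuple (measurableTypeR R)).

(** Induction on [n]: given the first coordinate, the rest of the sum follows the law from the
    induction hypothesis, and [normal_conv] adds the two. *)
Lemma tuple_measure_normal_linear (s : R) n (m a : 'I_n -> R) (A : set R) :
  s != 0 -> measurable A ->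
  tuple_measure (fun k => normal_prob (m k) s)
    [set t : Rn n | A (\sum_(k < n) a k * tnth t k)] =
  normal_or_dirac (\sum_(k < n) a k * m k)
    (Num.sqrt (\sum_(k < n) a k ^+ 2 * s ^+ 2)) A.
Proof.
move=> s0; elim: n m a A => [|n IH] m a A mA.
  (* The empty sum is the constant 0 with variance 0, which is the point-mass case. *)
  rewrite !big_ord0 sqrtr0 /normal_or_dirac eqxx/= !diracE.
  congr (_%:R%:E); congr nat_of_bool.
  by apply/idP/idP; rewrite !inE/= big_ord0.
rewrite !big_ord_recl /= /cons_measure /pushforward /product_measure1.
set m2 := \sum_(i < n) _ * m _; set v2 := \sum_(i < n) _ ^+ 2 * _.
have v20 : 0 <= v2 by apply: sumr_ge0 => i _; rewrite -exprMn sqr_ge0.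
rewrite -(sqr_sqrtr v20) -normal_conv//.
apply: eq_integral => x _ /=.
rewrite /m2 /v2 -(IH (fun i => m (lift ord0 i)) (fun i => a (lift ord0 i))).
  have sum_cons t : \sum_(k < n.+1) a k * tnth (cons_pair (x, t)) k =
      a ord0 * x + \sum_(k < n) a (lift ord0 k) * tnth t k.
    by rewrite big_ord_recl; congr (_ + _); apply: eq_bigr => k _; rewrite tnthS.
  congr (tuple_measure _ _); apply/seteqP; split => t /=;
    by rewrite /xsection/= ?inE/= sum_cons.
have mf : measurable_fun [set: measurableTypeR R] (fun y => a ord0 * x + y).
  by apply: measurable_funD.
by rewrite -[X in measurable X]setTI; exact: mf.
Qed.

Lemma measurable_prod_tnth n (f : 'I_n -> R -> R) :
  (forall k, measurable_fun setT (f k)) ->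
  measurable_fun [set: Rn n] (fun t => \prod_(k < n) f k (tnth t k)).
Proof.
move=> mf; apply: measurable_prod => k _.
exact: (measurableT_comp (mf k) (measurable_tnth k)).
Qed.

Lemma tuple_measure_density n
    (P : 'I_n -> {sigma_finite_measure set (measurableTypeR R) -> \bar R})
    (f : 'I_n -> R -> R) :
  (forall k, measurable_fun setT (f k)) -> (forall k x, 0 <= f k x) ->
  (forall k A, measurable A -> P k A = \int[mu]_(x in A) (f k x)%:E)%E ->
  forall A, measurable A ->
  (tuple_measure P A =
   \int[lebesgue_tuple n]_(t in A) (\prod_(k < n) f k (tnth t k))%:E)%E.
Proof.
elim: n P f => [|n IH] P f mf f0 PE A mA.
  rewrite /lebesgue_tuple /=.
  under eq_integral do rewrite big_ord0.
  by rewrite integral_cst//= mul1e.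
set g := fun t : Rn n => \prod_(k < n) f (lift ord0 k) (tnth t k).
have mg : measurable_fun setT g.
  exact: (measurable_prod_tnth n (fun k => f (lift ord0 k))).
have g0 t : 0 <= g t by apply: prodr_ge0.
set B := @cons_pair _ _ n @^-1` A.
have mB : measurable B.
  rewrite -[X in measurable X]setTI.
  exact: measurable_cons_pair.
pose F (p : measurableTypeR R * Rn n) : \bar R :=
  ((f ord0 p.1 * g p.2 * \1_B p)%:E)%E.
have F0 p : (0 <= F p)%E by rewrite lee_fin !mulr_ge0.
have mF : measurable_fun setT F.
  apply/measurable_EFinP; apply: measurable_funM; last exact: measurable_indic.
  apply: measurable_funM.
    exact: (measurableT_comp (mf ord0) measurable_fst).
  exact: (measurableT_comp mg measurable_snd).
transitivity (\int[(mu \x lebesgue_tuple n)%E]_p F p)%E; last first.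
  transitivity (\int[pushforward (mu \x lebesgue_tuple n)%E
                       (@cons_pair _ _ n)]_(t in A)
    (\prod_(k < n.+1) f k (tnth t k))%:E)%E; last first.
    by apply: eq_measure_integral.
  rewrite ge0_integral_pushforward//.
  - rewrite [RHS]integral_mkcond; apply: eq_integral => p _.
    rewrite /F patchE indicE; case: ifPn => _; rewrite ?mulr1 ?mulr0//=.
    rewrite big_ord_recl/=; congr (_ * _)%:E.
    by apply: eq_bigr => i _; rewrite tnthS.
  - by apply/measurable_EFinP/measurable_funTS; exact: (measurable_prod_tnth n.+1 f).
  - by move=> t _; rewrite lee_fin prodr_ge0.
rewrite fubini_tonelli1//.
rewrite /= /cons_measure /pushforward /product_measure1 -/B.
rewrite (@ge0_integral_density _ _ _ mu _ (f ord0))//; last 3 first.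
- exact: (mf ord0).
- exact: PE.
- exact: measurable_fun_xsection.
apply: eq_integral => x _; rewrite /fubini_F /F/=.
have mBx : measurable (xsection B x) by exact: measurable_xsection.
rewrite (IH _ (fun i => f (lift ord0 i)))//; last first.
  by move=> k C mC; exact: PE.
rewrite integral_mkcond -ge0_integralZr//; first last.
- by rewrite lee_fin.
- move=> t _; apply: erestrict_ge0 => u _; rewrite lee_fin; exact: g0.
- apply/(measurable_restrictT _ mBx)/measurable_EFinP/measurable_funTS.
  exact: mg.
apply: eq_integral => t _; rewrite patchE mem_xsection indicE.
by case: ifPn => _; rewrite ?mulr0 ?mul0e ?mulr1 -?EFinM// mulrC.
Qed.

End tuples.

Section Phi.
Context {R : realType}.
Implicit Types x y p : R.

Let idR : measurableTypeR R -> R := idfun.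

#[local] HB.instance Definition _ :=
  @isMeasurableFun.Build _ _ _ _ idR (@measurable_id _ _ setT).

Let PhiE x : Phi x = fine (cdf (idR : {RV (normal_prob 0 1) >-> R}) x).
Proof. by []. Qed.

Lemma Phi_lipschitz x y : x <= y ->
  0 <= Phi y - Phi x <= normal_peak 1 * (y - x).
Proof.
move=> xy; have yE : `]-oo, y]%classic = `]-oo, x] `|` `]x, y] :> set R.
  by rewrite -itv_bndbnd_setU// bnd_simp.
have -> : Phi y - Phi x = fine (normal_prob 0 1 `]x, y]).
  rewrite /Phi yE measureU//; last first.
    apply/seteqP; split => z //=; rewrite !in_itv/= => -[zx /andP[xz _]].
    by move: (lt_le_trans xz zx); rewrite ltxx.
  rewrite fineD ?fin_num_measure//.
  by rewrite addrAC subrr add0r.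
rewrite fine_ge0//= -lee_fin fineK ?fin_num_measure//.
apply: (@le_trans _ _
    (\int[lebesgue_measure]_(z in `]x, y]) (normal_peak 1)%:E)%E).
  apply: ge0_le_integral => //.
  - by move=> z _; rewrite lee_fin normal_pdf_ge0.
  - by apply/measurable_EFinP/measurable_funTS; exact: measurable_normal_pdf.
  - by move=> z _; rewrite lee_fin normal_pdf_ub// oner_neq0.
rewrite integral_cst//= lebesgue_measure_itv/= lte_fin.
case: ltP => _; first by rewrite EFinM EFinB.
by rewrite mule0 lee_fin mulr_ge0 ?normal_peak_ge0// subr_ge0.
Qed.

Lemma continuous_Phi : continuous (@Phi R).
Proof.
have k0 : 0 < normal_peak 1 :> R by rewrite normal_peak_gt0// oner_neq0.
move=> x; apply/cvgrPdist_le => e e0.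
near=> y.
have xy : `|x - y| <= e / normal_peak 1.
  by near: y; apply: cvgr_dist_le => //; rewrite divr_gt0.
rewrite ler_pdivlMr// mulrC in xy.
apply: le_trans xy.
have [xy|/ltW yx] := leP x y.
  have /andP[h0 h1] := Phi_lipschitz _ _ xy.
  by rewrite distrC ger0_norm// distrC ger0_norm// subr_ge0.
have /andP[h0 h1] := Phi_lipschitz _ _ yx.
by rewrite ger0_norm// ger0_norm// subr_ge0.
Unshelve. all: by end_near. Qed.

Lemma Phi_invK p : 0 < p < 1 -> Phi (Phi_inv p) = p.
Proof.
move=> /andP[p0 p1].
have [b /ltW pb] : exists b, p < Phi b.
  have /fine_cvg/cvgr_gt/(_ p p1) :=
    cvg_cdfy1 (idR : {RV (normal_prob 0 1) >-> R}).
  by move/filter_ex => [b]; exists b.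
have [a /ltW pa] : exists a, Phi a < p.
  have /fine_cvg/cvgr_lt/(_ p p0) :=
    cvg_cdfNy0 (idR : {RV (normal_prob 0 1) >-> R}).
  by move/filter_ex => [a]; exists a.
suff [z Pz] : exists z, Phi z = p.
  by apply: (@pinvK _ _ (fun=> 0) [set: R] Phi); rewrite inE; exists z.
have [ab|/ltW ba] := leP a b.
  have [|c _ <-] := @IVT R Phi a b p ab (continuous_subspaceT continuous_Phi).
    by rewrite min_l ?max_r ?pa ?pb// (le_trans pa).
  by exists c.
have /andP[+ _] := Phi_lipschitz _ _ ba.
rewrite subr_ge0 => h; exists a; apply/eqP.
by rewrite eq_le pa (le_trans pb).
Qed.

End Phi.

Section privacy.
Context {R : realType}.
Implicit Types (x y q m : R).

Lemma normal_prob_standardize m y A : y != 0 -> measurable A ->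
  normal_prob m y A = normal_prob 0 1 ((fun z : R => y * z + m) @^-1` A).
Proof.
move=> y0 mA.
have := normal_prob_affine y m y0 0 1 A (oner_neq0 _) mA.
by rewrite mulr0 add0r mulr1 => <-.
Qed.

Lemma Phi_compl x : normal_prob 0 1 `[- x, +oo[ = (Phi x)%:E.
Proof.
have N1 : normal_prob 0 1 = normal_prob 0 (- 1) :> (set R -> \bar R).
  by apply: normal_prob_sqr; rewrite sqrrN.
rewrite /Phi fineK ?fin_num_measure// [X in _ = X _]N1.
rewrite [RHS]normal_prob_standardize ?oppr_eq0 ?oner_eq0//.
congr (normal_prob 0 1 _); apply/seteqP; split => z /=;
  by rewrite !in_itv/= andbT addr0 mulN1r lerNl.
Qed.

Lemma normr_lt_sqrtr_sqrD q e : 0 < e -> `|q| < Num.sqrt (q ^+ 2 + e).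
Proof.
move=> e0; rewrite -sqrtr_sqr ltr_sqrt ?ltrDl//.
by rewrite ltr_wpDl// sqr_ge0.
Qed.

Lemma measurable_normr_gt e (c d : R) :
  measurable [set y | e < `|y - c + d|].
Proof.
have mf : measurable_fun [set: R] (fun y => `|y - c + d|).
  apply: measurableT_comp => //; apply: measurable_funD => //.
  exact: measurable_funB.
have := mf measurableT _ (measurable_itv `]e, +oo[).
rewrite setTI (_ : _ @^-1` _ = [set y | e < `|y - c + d|])//.
by apply/seteqP; split => y /=; rewrite in_itv/= andbT.
Qed.

Lemma normal_prob_privacy_loss m (eps delta eta : R) : 0 < eps ->
  0 < delta < 1 -> 0 < eta ->
  eta <= Num.sqrt (Phi_inv (delta / 2) ^+ 2 + 2 * eps) + Phi_inv (delta / 2) ->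
  (normal_prob m eta [set y | (eps < `|y - m + eta ^+ 2 / 2|)%R] <= delta%:E)%E.
Proof.
move=> eps0 /andP[delta0 delta1] eta0.
set q := Phi_inv _; set S := Num.sqrt _ => etaS.
have S2 : S ^+ 2 = q ^+ 2 + 2 * eps.
  by rewrite sqr_sqrtr// addr_ge0 ?sqr_ge0// mulr_ge0// ltW.
have qS : q < S.
  by rewrite (le_lt_trans (ler_norm q))// normr_lt_sqrtr_sqrD// mulr_gt0.
(* equivalently [-q <= eps / eta - eta / 2] *)
have key : eta ^+ 2 / 2 - q * eta <= eps.
  have h1 : 0 <= S - (eta - q) by lra.
  have h2 : 0 <= S + (eta - q) by lra.
  have := mulr_ge0 h1 h2; nra.
have meas_affine (c : R) (A : set R) : measurable A ->
    measurable ((fun z : measurableTypeR R => eta * z + c) @^-1` A).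
  have mf : measurable_fun [set: measurableTypeR R] (fun z => eta * z + c).
    by apply: measurable_funD => //; exact: measurable_funM.
  by move=> mA; rewrite -[X in measurable X]setTI; exact: mf.
rewrite normal_prob_standardize ?gt_eqF//; last exact: measurable_normr_gt.
have Phiq : Phi q = delta / 2.
  by apply: Phi_invK; rewrite divr_gt0//=; lra.
apply: (@le_trans _ _ (normal_prob 0 1 (`]-oo, q] `|` `[- q, +oo[))).
  apply: le_measure; rewrite ?inE//.
  - by apply: meas_affine; exact: measurable_normr_gt.
  - exact: measurableU.
  - move=> z /=; rewrite !in_itv/= andbT addrK ltr_normr => /orP[h|h].
      right; rewrite leNgt; apply/negP => zq.
      have : eta * z < eta * - q by rewrite ltr_pM2l.
      lra.
    left; rewrite leNgt; apply/negP => zq.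
    have : eta * q < eta * z by rewrite ltr_pM2l.
    have := sqr_ge0 eta.
    lra.
have PhiE : normal_prob 0 1 `]-oo, q] = (Phi q)%:E.
  by rewrite /Phi fineK ?fin_num_measure.
have -> : delta%:E = ((Phi q)%:E + (Phi q)%:E)%E.
  by rewrite -EFinD Phiq -splitr.
rewrite -{1}PhiE -Phi_compl.
exact: measureU2.
Qed.

Lemma normal_pdf_ratio (m m' s x : R) : s != 0 ->
  normal_pdf m s x = normal_pdf m' s x *
  expR ((m - m') / s ^+ 2 * x -
        ((m - m') / s ^+ 2 * m - (m - m') ^+ 2 / s ^+ 2 / 2)).
Proof.
move=> s0; rewrite !normal_pdfE// -[RHS]mulrA; congr (_ * _).
by rewrite /normal_fun -expRD; congr expR; field.
Qed.

Lemma prod_normal_pdf_ratio n (u v : 'I_n -> R) (s : R) (t : 'I_n -> R) : s != 0 ->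
  \prod_(k < n) normal_pdf (u k) s (t k) =
  \prod_(k < n) normal_pdf (v k) s (t k) *
  expR (\sum_(k < n) (u k - v k) / s ^+ 2 * t k -
        \sum_(k < n) (u k - v k) / s ^+ 2 * u k +
        (\sum_(k < n) (u k - v k) ^+ 2) / s ^+ 2 / 2).
Proof.
move=> s0.
rewrite (eq_bigr _ (fun k _ => normal_pdf_ratio (u k) (v k) s (t k) s0)).
rewrite big_split/= -expR_sum; congr (_ * expR _).
by rewrite !sumrB !mulr_suml opprB [X in _ + X]addrC addrA.
Qed.

End privacy.

Theorem lemma10 (R : realType) (X : Type) (nbr : X -> X -> Prop)
  (nbr_sym : forall x x', nbr x x' -> nbr x' x)
  (eps delta : R) (eps_gt0 : 0 < eps) (delta_gt0 : 0 < delta)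
  (delta_lt1 : delta < 1)
  (r : nat) (s : X -> r.-tuple R)
  (s_fin : has_ubound (neighbor_l2_dists nbr s))
  (b : R) (b_gt0 : 0 < b)
  (hb : (Num.sqrt 2)^-1 * eps^-1 * l2_sensitivity nbr s *
        (Num.sqrt (Phi_inv (delta / 2) ^+ 2 + 2 * eps) - Phi_inv (delta / 2))
        <= b) :
  pDP nbr (gaussian_mechanism s b) eps delta.
Proof.
set sigma := Num.sqrt (b ^+ 2 / 2).
have sigma2 : sigma ^+ 2 = b ^+ 2 / 2.
  by rewrite sqr_sqrtr// divr_ge0// sqr_ge0.
have sigma_gt0 : 0 < sigma.
  by rewrite sqrtr_gt0 divr_gt0// exprn_gt0.
have sigma0 : sigma != 0 by rewrite gt_eqF.
set q := Phi_inv (delta / 2) in hb *.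
set S := Num.sqrt (q ^+ 2 + 2 * eps) in hb *.
have S2 : S ^+ 2 = q ^+ 2 + 2 * eps.
  by rewrite sqr_sqrtr// addr_ge0 ?sqr_ge0// mulr_ge0// ltW.
have Sq_gt0 : 0 < S + q.
  rewrite -ltrBlDr sub0r (le_lt_trans (ler_norm (- q)))// normrN.
  by rewrite normr_lt_sqrtr_sqrD// mulr_gt0.
have l2E x x' : l2_dist (s x) (s x') ^+ 2 =
    \sum_(k < r) (tnth (s x) k - tnth (s x') k) ^+ 2.
  by rewrite sqr_sqrtr// sumr_ge0// => k _; exact: sqr_ge0.
have distS x x' : nbr x x' -> l2_dist (s x) (s x') <= sigma * (S + q).
  move=> xx'; apply: (@le_trans _ _ (l2_sensitivity nbr s)).
    by apply: sup_upper_bound; [split=> //; eexists|]; exists x, x'.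
  have sigmaE : sigma = b / Num.sqrt 2.
    by rewrite /sigma sqrtrM ?sqr_ge0// sqrtr_sqr sqrtrV// gtr0_norm.
  have r2 : 0 < Num.sqrt 2 :> R by rewrite sqrtr_gt0.
  have r22 : Num.sqrt 2 ^+ 2 = 2 :> R by rewrite sqr_sqrtr.
  set D := l2_sensitivity nbr s in hb *.
  have -> : D = (Num.sqrt 2)^-1 *
      ((Num.sqrt 2)^-1 * eps^-1 * D * (S - q)) * (S + q).
    rewrite (_ : _ * _ * (S + q) =
      (Num.sqrt 2 ^+ 2)^-1 * eps^-1 * D * (S ^+ 2 - q ^+ 2)); last first.
      by field; rewrite !gt_eqF.
    by rewrite r22 S2; field; rewrite gt_eqF.
  by rewrite sigmaE ler_pM2r// mulrC ler_pM2r ?invr_gt0.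
pose f x (t : r.-tuple (measurableTypeR R)) : R :=
  \prod_(k < r) normal_pdf (tnth (s x) k) sigma (tnth t k).
have f_gt0 x t : 0 < f x t.
  apply: prodr_gt0 => k _; rewrite normal_pdfE// mulr_gt0 ?expR_gt0//.
  exact: normal_peak_gt0.
exists f; split => [x|x x' xx'].
  split.
  - apply: (measurable_prod_tnth r (fun k => normal_pdf (tnth (s x) k) sigma)).
    by move=> k; exact: measurable_normal_pdf.
  - by move=> t; rewrite ltW.
  - move=> A mA; apply: (tuple_measure_density r _
      (fun k => normal_pdf (tnth (s x) k) sigma)) => //.
    + by move=> k; exact: measurable_normal_pdf.
    + by move=> k y; exact: normal_pdf_ge0.
pose d k := tnth (s x) k - tnth (s x') k.
pose a k := d k / sigma ^+ 2.
set D := l2_dist (s x) (s x').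
have D0 : 0 <= D by exact: sqrtr_ge0.
pose eta := D / sigma.
pose M := \sum_(k < r) a k * tnth (s x) k.
have lossE t : lne ((f x t)%:E / (f x' t)%:E) =
    (\sum_(k < r) a k * tnth t k - M + eta ^+ 2 / 2)%:E.
  rewrite inver gt_eqF// -EFinM lne_EFin ?divr_gt0//; congr (_%:E).
  rewrite {1}/f (prod_normal_pdf_ratio _ _ (tnth (s x')) _ (tnth t))//.
  rewrite -/(f x' t) mulrAC divff ?gt_eqF// mul1r expRK.
  by rewrite -l2E /eta exprMn exprVn.
pose A := [set y : R | eps < `|y - M + eta ^+ 2 / 2|].
have mA : measurable A by exact: measurable_normr_gt.
rewrite (_ : [set t | _] = [set t | A (\sum_(k < r) a k * tnth t k)]); last first.
  by apply/seteqP; split => t /=; rewrite lossE /= lte_fin.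
rewrite [X in (X <= _)%E](tuple_measure_normal_linear _ _ _ a)// -/M.
have -> : Num.sqrt (\sum_(k < r) a k ^+ 2 * sigma ^+ 2) = eta.
  rewrite (_ : \sum_(k < r) _ = eta ^+ 2).
    by rewrite sqrtr_sqr ger0_norm// divr_ge0// ltW.
  rewrite /eta exprMn exprVn l2E mulr_suml; apply: eq_bigr => k _.
  by rewrite /a /d; field.
rewrite /normal_or_dirac; case: ifPn => [/eqP eta0|eta0].
  rewrite diracE memNset ?lee_fin ?ltW// /A /= eta0 subrr expr0n/= mul0r addr0.
  by rewrite normr0; apply/negP; rewrite -leNgt ltW.
apply: normal_prob_privacy_loss => //.
- exact/andP.
- by rewrite lt0r eta0 divr_ge0// ltW.
- by rewrite ler_pdivrMr// mulrC; exact: distS.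
Qed.
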